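(* Let $(w^n,q^n)_{n\ge0}$ be generated, with fixed timestep $k=\triangle t>0$, by the scheme (Method 1): given $w^0$, for $n\ge 0$, $$\frac{w^{n+1}-w^n}{k}+\beta^2a^n\frac{a^nw^{n+1}-a^{n-1}w^n}{k}+w^n\cdot\nabla w^{n+1}-\nabla\cdot\big([\nu+\nu_T^n]\nabla w^{n+1}\big)+\nabla q^{n+1}=f^{n+1}\ \text{ in }\Omega,$$ $$\nabla\cdot w^{n+1}=0\ \text{ in }\Omega,\qquad w^{n+1}=0\ \text{ on }\partial\Omega .$$ Let $$MD^{n+1}:=\int_\Omega\beta^2a^n\frac{a^nw^{n+1}-a^{n-1}w^n}{k}\cdot w^{n+1}+\nu_T^n|\nabla w^{n+1}|^2\,dx .$$ Suppose $\sup_{0<n<\infty}\|f(t_n)\|<\infty$. Then, for $T_N=N\triangle t$, $$\liminf_{T_N\to\infty}\frac1{T_N}\Big(\triangle t\sum_{n=0}^{N}MD^{n+1}\Big)\ge0 .$$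
   Context: $\Omega\subset\mathbb{R}^d$ ($d=2,3$) is a bounded domain, $\nu>0$ and $\beta>0$ are constants, and $\|\cdot\|$ is the $L^2(\Omega)$ norm. $\nu_T(w)\ge0$ is a given eddy viscosity (a nonnegative scalar function on $\Omega$ determined by the velocity field $w$), and $a(w):=\sqrt{\nu^{-1}\nu_T(w)}$. Notation: $t_n=nk$, $f^n(x)=f(x,t_n)$, $a^n:=a(w^n)$, $\nu_T^n:=\nu_T(w^n)$ for $n\ge0$, and $a^{-1}:=a^0=a(w^0)$. There is no spatial discretization. The initial velocity $w^0$ is divergence free and vanishes on $\partial\Omega$; the $w^n$ are assumed to be solutions regular enough that all integrals appearing are finite and the momentum equation can be tested with $w^{n+1}$, with the usual integrations by parts. *)

(* Defs.v *)
From HB Require Import structures.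
From mathcomp Require Import all_boot all_order all_algebra.
From mathcomp Require Import all_classical all_reals all_analysis.
From mathcomp Require Import measurable_realfun lra.
Set Implicit Arguments.
Unset Strict Implicit.
Unset Printing Implicit Defensive.
Import Order.TTheory GRing.Theory Num.Theory.
Import numFieldNormedType.Exports.
Local Open Scope classical_set_scope.
Local Open Scope ring_scope.

Fact rV_display : measure_display.
Proof. exact: default_measure_display. Qed.

(* The Borel sigma-algebra of R^n. *)
Section rV_measurable.
Context {R : realType} {n : nat}.
Let G : set (set 'rV[R]_n) := [set U | open U].
HB.instance Definition _ := @isMeasurable.Build rV_display 'rV[R]_n <<s G >>
  (@sigma_algebra0 _ _ _) (@sigma_algebraC _ _) (@sigma_algebra_bigcup _ _ _).

Lemma open_rV_measurable (U : set 'rV[R]_n) : open U -> measurable U.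
Proof. by move=> oU; exact: sub_sigma_algebra. Qed.

Lemma measurable_rV_of_open d (T : measurableType d) (f : T -> 'rV[R]_n) :
  (forall U, open U -> measurable (f @^-1` U)) -> measurable_fun setT f.
Proof.
move=> mf; apply: (@measurability _ _ _ _ setT f G) => //.
by move=> _ [U oU <-]; rewrite setTI; exact: mf.
Qed.
End rV_measurable.


Lemma coord_measurable (R : realType) n (i : 'I_n) :
  measurable_fun setT (fun v : 'rV[R]_n => v ord0 i).
Proof.
apply: (measurability _ (RGenOpens.measurableE R)).
move=> _ [_ [a [b ->]] <-]; rewrite setTI.
apply: open_rV_measurable; apply: open_comp => [v _|]; last exact: interval_open.
exact: coord_continuous.
Qed.


(* Lebesgue measure on R^n is obtained by induction on n, as the image of the
   product measure under the bijection R * R^n -> R^(n+1); it is characterized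
   by lebesgue_rV_box below. *)
Section cons_rV.
Context {R : realType} {n : nat}.

Definition cons_rV (p : R * 'rV[R]_n) : 'rV[R]_n.+1 :=
  \row_i oapp (p.2 ord0) p.1 (unlift ord0 i).

Definition uncons_rV (v : 'rV[R]_n.+1) : R * 'rV[R]_n :=
  (v ord0 ord0, rsubmx (v : 'rV[R]_(1 + n))).

Lemma cons_rV0 p : cons_rV p ord0 ord0 = p.1.
Proof. by rewrite mxE unlift_none. Qed.

Lemma cons_rVS p i : cons_rV p ord0 (lift ord0 i) = p.2 ord0 i.
Proof. by rewrite mxE liftK. Qed.

Lemma uncons_rV2 v i : (uncons_rV v).2 ord0 i = v ord0 (lift ord0 i).
Proof. by rewrite mxE; congr (_ _ _); exact: val_inj. Qed.

Lemma cons_rVK : cancel cons_rV uncons_rV.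
Proof.
move=> [r v]; rewrite [LHS]surjective_pairing; congr pair.
  exact: cons_rV0.
by apply/rowP => i; rewrite uncons_rV2 cons_rVS.
Qed.

Lemma uncons_rVK : cancel uncons_rV cons_rV.
Proof.
move=> v; apply/rowP => i.
by have [j ->|->] := unliftP ord0 i; rewrite ?cons_rVS ?cons_rV0// uncons_rV2.
Qed.

Lemma measurable_uncons_rV : measurable_fun setT uncons_rV.
Proof.
apply: measurable_fun_pair; first exact: coord_measurable.
apply: measurable_rV_of_open => U oU; apply: open_rV_measurable.
apply: open_comp => // v _; exact: continuous_rsubmx.
Qed.

Let ratball (q : 'rV[rat]_n.+1 * rat) : set 'rV[R]_n.+1 :=
  [set v | forall i, ball (ratr (q.1 ord0 i) : R) (ratr q.2) (v ord0 i)].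

Let preimage_ratball q : cons_rV @^-1` ratball q =
  ball (ratr (q.1 ord0 ord0) : R) (ratr q.2) `*`
  \bigcap_(i in [set: 'I_n]) ((fun v : 'rV[R]_n => v ord0 i)
   @^-1` ball (ratr (q.1 ord0 (lift ord0 i)) : R) (ratr q.2)).
Proof.
apply/seteqP; split => [p /= H|p /= [H0 H1] i].
  by split=> [|i _]; [rewrite -cons_rV0|rewrite /= -cons_rVS]; exact: H.
by have [j ->|->] := unliftP ord0 i; [rewrite cons_rVS; exact: H1|rewrite cons_rV0].
Qed.

Let measurable_preimage_ratball q : measurable (cons_rV @^-1` ratball q).
Proof.
rewrite preimage_ratball; apply: measurableX; first exact: open_measurable (ball_open _ _).
apply: fin_bigcap_measurable => // i _; rewrite -[X in measurable X]setTI.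
by apply: coord_measurable => //; exact: open_measurable (ball_open _ _).
Qed.

Let open_ratball (U : set 'rV[R]_n.+1) : open U ->
  U = \bigcup_(q in [set q | ratball q `<=` U]) ratball q.
Proof.
move=> oU; apply/seteqP; split=> [v Uv|v [q /= qU qv]]; last exact: qU.
have [e /= e0 eU] : nbhs_ball v U by apply/nbhs_ballP; exact: open_nbhs_nbhs.
have [r] := rat_in_itvoo (divr_gt0 e0 (ltr0Sn R 1)).
rewrite in_itv/= => /andP[r0 re].
have /choice[g Hg] : forall i, exists q : rat, ball (v ord0 i) (ratr r) (ratr q : R).
  move=> i; have [|q] := @rat_in_itvoo R (v ord0 i) (v ord0 i + ratr r).
    by rewrite ltrDl.
  rewrite in_itv/= => /andP[q1 q2]; exists q.
  by rewrite /ball/= ltr_distlC; apply/andP; split; lra.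
exists (\row_i g i, r) => /=.
  move=> u /= H; apply: eU; split => // i j; rewrite (ord1 i).
  have := H j; rewrite mxE => /(ball_triangle (Hg j)).
  by apply: le_ball; lra.
by move=> i; rewrite mxE; exact/ball_sym.
Qed.

Lemma measurable_cons_rV : measurable_fun setT cons_rV.
Proof.
apply: measurable_rV_of_open => U /open_ratball ->.
rewrite preimage_bigcup bigcup_mkcond.
apply: countable_bigcupT_measurable => [|q]; first exact: countableP.
by case: ifP => // _; exact: measurable_preimage_ratball.
Qed.

Variable m : {sigma_finite_measure set 'rV[R]_n -> \bar R}.

Definition cons_measure : set 'rV[R]_n.+1 -> \bar R :=
  pushforward (lebesgue_measure \x m)%E cons_rV.

Let pf : {measure set 'rV[R]_n.+1 -> \bar R} :=
  measure_function_pushforward__canonical__measure_function_Measure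
    (lebesgue_measure \x m)%E measurable_cons_rV.

HB.instance Definition _ := isMeasure.Build _ _ _ cons_measure
  (measure0 pf) (measure_ge0 pf) (@measure_semi_sigma_additive _ _ _ pf).

Let sigma_finite_cons_measure : sigma_finite setT cons_measure.
Proof.
have /sigma_finiteP[F [TF ndF Foo]] := sigma_finiteT (@lebesgue_measure R).
have /sigma_finiteP[G [TG ndG Goo]] := sigma_finiteT m.
have E i : cons_rV @^-1` (uncons_rV @^-1` (F i `*` G i)) = F i `*` G i.
  rewrite -comp_preimage (_ : _ \o _ = id)//; apply/funext => p.
  exact: cons_rVK.
exists (fun i => uncons_rV @^-1` (F i `*` G i)) => [|i].
  rewrite -preimage_bigcup (_ : \bigcup_i _ = setT) ?preimage_setT//.
  apply/seteqP; split => // -[x y] _.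
  have [i _ Fx] : (\bigcup_i F i) x by rewrite -TF.
  have [j _ Gy] : (\bigcup_i G i) y by rewrite -TG.
  exists (maxn i j) => //; split.
    by move: x Fx; exact/subsetPset/ndF/leq_maxl.
  by move: y Gy; exact/subsetPset/ndG/leq_maxr.
have [mF Ffin] := Foo i; have [mG Gfin] := Goo i; split.
  rewrite -[X in measurable X]setTI; apply: measurable_uncons_rV => //.
  exact: measurableX.
rewrite /cons_measure /pushforward E product_measure1E// lte_mul_pinfty//.
by rewrite ge0_fin_numE.
Qed.

HB.instance Definition _ := @Measure_isSigmaFinite.Build _ _ _ cons_measure sigma_finite_cons_measure.

End cons_rV.

Fixpoint lebesgue_rV {R : realType} (n : nat) : {sigma_finite_measure set 'rV[R]_n -> \bar R} :=
  match n with
  | 0 => \d_(0 : 'rV[R]_0)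
  | n.+1 => cons_measure (lebesgue_rV n)
  end.

Lemma lebesgue_rV_box (R : realType) n (I : 'I_n -> interval R) :
  lebesgue_rV n [set v | forall i, v ord0 i \in I i] = (\prod_(i < n) lebesgue_measure [set` I i])%E.
Proof.
elim: n I => [|n IH] I.
  rewrite big_ord0 /= diracE mem_set//= => -[]//.
set B : set 'rV[R]_n := [set v | forall i, v ord0 i \in I (lift ord0 i)].
have mB : measurable B.
  rewrite (_ : B = \bigcap_(i in [set: 'I_n]) ((fun v : 'rV[R]_n => v ord0 i)
     @^-1` [set` I (lift ord0 i)])).
    apply: fin_bigcap_measurable => // i _; rewrite -[X in measurable X]setTI.
    by apply: coord_measurable => //; exact: measurable_itv.
  by apply/seteqP; split => [v H i _|v H i]; [exact: H|exact: (H i)].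
rewrite big_ord_recl -IH /= /cons_measure /pushforward -/B -product_measure1E//.
congr (product_measure1 _ _ _); apply/seteqP; split => [p /= H|p /= [H0 H1] i].
  by split=> [|i]; [rewrite -cons_rV0|rewrite -cons_rVS]; exact: H.
by have [j ->|->] := unliftP ord0 i; [rewrite cons_rVS; exact: H1|rewrite cons_rV0].
Qed.

Section vector_calculus.
Context {R : realType} {d : nat}.
Implicit Types (u v : 'rV[R]_d -> 'rV[R]_d) (p : 'rV[R]_d -> R)
  (F : 'rV[R]_d -> 'M[R]_d) (x : 'rV[R]_d).

(* The mathcomp-analysis norm on matrices is the sup norm; inner m n A A is the
   squared Euclidean (m = 1) or Frobenius norm. *)
Definition inner m n (A B : 'M[R]_(m, n)) : R := \sum_i \sum_j A i j * B i j.

Definition partial (j : 'I_d) p x : R := 'D_(delta_mx ord0 j) p x.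

Definition has_partial (j : 'I_d) p x : Prop := derivable p x (delta_mx ord0 j).

Definition grad p x : 'rV[R]_d := \row_j partial j p x.

Definition vgrad v x : 'M[R]_d :=
  \matrix_(i, j) partial j (fun y => v y ord0 i) x.

Definition divergence v x : R := \sum_j partial j (fun y => v y ord0 j) x.

Definition tdivergence F x : 'rV[R]_d :=
  \row_i \sum_j partial j (fun y => F y i j) x.

Definition advection u v x : 'rV[R]_d :=
  \row_i \sum_j u x ord0 j * partial j (fun y => v y ord0 i) x.

End vector_calculus.

Definition boundary {T : topologicalType} (A : set T) : set T :=
  closure A `\` interior A.

Section lebesgue_space.
Context {R : realType} {d : nat} (Omega : set 'rV[R]_d).
Local Notation mu := (lebesgue_rV d).

Definition L2norm (u : 'rV[R]_d -> 'rV[R]_d) : \bar R :=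
  'N[mu]_2%:E[(EFin \o (fun x => Num.sqrt (inner (u x) (u x)))) \_ Omega]%E.

Definition intble (g : 'rV[R]_d -> R) : Prop :=
  mu.-integrable Omega (EFin \o g).

Definition square_integrable m n (A : 'rV[R]_d -> 'M[R]_(m, n)) : Prop :=
  (forall i j, measurable_fun Omega (fun x => A x i j)) /\
  intble (fun x => inner (A x) (A x)).

End lebesgue_space.

Section method1.
Context {R : realType} {d : nat} (Omega : set 'rV[R]_d) (nu beta k : R)
  (nuT : ('rV[R]_d -> 'rV[R]_d) -> 'rV[R]_d -> R)
  (f : 'rV[R]_d -> R -> 'rV[R]_d)
  (w : nat -> 'rV[R]_d -> 'rV[R]_d) (q : nat -> 'rV[R]_d -> R).
Local Notation mu := (lebesgue_rV d).

Definition time (n : nat) : R := n%:R * k.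

Definition eddy_a (v : 'rV[R]_d -> 'rV[R]_d) (x : 'rV[R]_d) : R :=
  Num.sqrt (nu^-1 * nuT v x).

Definition a_ (n : nat) : 'rV[R]_d -> R := eddy_a (w n).

(* a_prev n is a^(n-1); since 0.-1 = 0, a_prev 0 is a^(-1) = a^0. *)
Definition a_prev (n : nat) : 'rV[R]_d -> R := eddy_a (w n.-1).

Definition backscatter (n : nat) (x : 'rV[R]_d) : 'rV[R]_d :=
  (beta ^+ 2 * a_ n x) *:
    (k^-1 *: (a_ n x *: w n.+1 x - a_prev n x *: w n x)).

(* [nu + nu_T^n] grad w^(n+1) *)
Definition viscous_flux (n : nat) (x : 'rV[R]_d) : 'M[R]_d :=
  (nu + nuT (w n) x) *: vgrad (w n.+1) x.

Definition momentum_equation (n : nat) (x : 'rV[R]_d) : Prop :=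
  k^-1 *: (w n.+1 x - w n x) + backscatter n x
  + advection (w n) (w n.+1) x - tdivergence (viscous_flux n) x
  + grad (q n.+1) x = f x (time n.+1).

Record method1_solution : Prop := {
  initial_divfree : forall x, Omega x -> divergence (w 0%N) x = 0 ;
  initial_boundary : forall x, boundary Omega x -> w 0%N x = 0 ;
  scheme_momentum : forall n x, Omega x -> momentum_equation n x ;
  scheme_divfree : forall n x, Omega x -> divergence (w n.+1) x = 0 ;
  scheme_boundary : forall n x, boundary Omega x -> w n.+1 x = 0
}.

(* The standing regularity assumption: the derivatives in the scheme exist, the
   integrals obtained by testing with w^(n+1) are finite, and the three usual
   integrations by parts hold (no regularity of the boundary of Omega is
   assumed from which they could be derived). *)
Record method1_regular : Prop := {
  velocity_continuous : forall n, {within closure Omega, continuous (w n)} ;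
  velocity_partial : forall n i j x, Omega x ->
    has_partial j (fun y => w n y ord0 i) x ;
  flux_partial : forall n i j x, Omega x ->
    has_partial j (fun y => viscous_flux n y i j) x ;
  pressure_partial : forall n j x, Omega x -> has_partial j (q n.+1) x ;

  eddy_measurable : forall n, measurable_fun Omega (nuT (w n)) ;
  force_L2 : forall n, square_integrable Omega (fun x => f x (time n.+1)) ;
  velocity_L2 : forall n, square_integrable Omega (w n) ;
  gradient_L2 : forall n, square_integrable Omega (vgrad (w n.+1)) ;
  a_velocity_L2 : forall n,
    square_integrable Omega (fun x => a_ n x *: w n.+1 x) ;
  a_prev_velocity_L2 : forall n,
    square_integrable Omega (fun x => a_prev n x *: w n x) ;
  eddy_dissipation_intble : forall n, intble Omega (fun x =>
    nuT (w n) x * inner (vgrad (w n.+1) x) (vgrad (w n.+1) x)) ;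
  advection_intble : forall n, intble Omega (fun x =>
    inner (advection (w n) (w n.+1) x) (w n.+1 x)) ;
  viscous_intble : forall n, intble Omega (fun x =>
    inner (tdivergence (viscous_flux n) x) (w n.+1 x)) ;
  pressure_intble : forall n, intble Omega (fun x =>
    inner (grad (q n.+1) x) (w n.+1 x)) ;

  advection_by_parts : forall n,
    \int[mu]_(x in Omega) inner (advection (w n) (w n.+1) x) (w n.+1 x) =
    - \int[mu]_(x in Omega) (divergence (w n) x * inner (w n.+1 x) (w n.+1 x)
        + inner (w n.+1 x) (advection (w n) (w n.+1) x)) ;
  viscous_by_parts : forall n,
    \int[mu]_(x in Omega) inner (tdivergence (viscous_flux n) x) (w n.+1 x) =
    - \int[mu]_(x in Omega) inner (viscous_flux n x) (vgrad (w n.+1) x) ;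
  pressure_by_parts : forall n,
    \int[mu]_(x in Omega) inner (grad (q n.+1) x) (w n.+1 x) =
    - \int[mu]_(x in Omega) (q n.+1 x * divergence (w n.+1) x)
}.

(* MD n is the model dissipation MD^(n+1). *)
Definition MD (n : nat) : R :=
  \int[mu]_(x in Omega)
    (inner (backscatter n x) (w n.+1 x)
     + nuT (w n) x * inner (vgrad (w n.+1) x) (vgrad (w n.+1) x)).

End method1.

(* Main.v *)
Require Import Defs.
From HB Require Import structures.
From mathcomp Require Import all_boot all_order all_algebra.
From mathcomp Require Import all_classical all_reals all_analysis.
From mathcomp Require Import measurable_realfun ring lra.
Import Order.TTheory GRing.Theory Num.Theory.
Import numFieldNormedType.Exports.
Local Open Scope classical_set_scope.
Local Open Scope ring_scope.

(** Up to a nonnegative term, the model dissipation of one step is a discrete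
    time derivative, so its sum over [N] steps is bounded below uniformly in
    [N] and its time average cannot stay negative.

    In detail, put [X := a^n w^(n+1)] and [Y := a^(n-1) w^n].  The backscatter
    term tested with [w^(n+1)] is [beta^2 / k * (X - Y, X)], and by the
    polarization identity [(X - Y, X) = (|X|^2 - |Y|^2 + |X - Y|^2) / 2] the
    factor [(X - Y, X)] is at least half the increment of [|Y|^2] over one step;
    the eddy dissipation is nonnegative.
    Hence ([MD_ge])
      [k MD^(n+1) >= beta^2 / 2 * (E_(n+1) - E_n)]
    with [E_n := ||a^(n-1) w^n||^2], and the sum over [n] telescopes to at least
    [- beta^2 / 2 * E_0], a bound that does not depend on [N] ([sum_MD_ge]).
    Dividing by [T_N] and letting [N] tend to infinity gives the claim.

    The one analytic point is that the pointwise bound passes to the integrals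
    only for integrable functions, so the cross term [(Y, X)] must be shown
    integrable ([intble_inner]); this is where the square integrability of [X]
    and [Y] enters. *)

Section inner_product.
Context {R : realType} {m n : nat}.
Implicit Types A B C : 'M[R]_(m, n).

Lemma inner_ge0 A : 0 <= inner A A.
Proof.
by apply: sumr_ge0 => i _; apply: sumr_ge0 => j _; rewrite -expr2 sqr_ge0.
Qed.

Lemma innerBl A B C : inner (A - B) C = inner A C - inner B C.
Proof.
rewrite /inner -sumrB; apply: eq_bigr => i _; rewrite -sumrB.
by apply: eq_bigr => j _; rewrite !mxE mulrBl.
Qed.

Lemma innerZl c A B : inner (c *: A) B = c * inner A B.
Proof.
rewrite /inner mulr_sumr; apply: eq_bigr => i _; rewrite mulr_sumr.
by apply: eq_bigr => j _; rewrite mxE mulrA.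
Qed.

Lemma innerZr c A B : inner A (c *: B) = c * inner A B.
Proof.
rewrite /inner mulr_sumr; apply: eq_bigr => i _; rewrite mulr_sumr.
by apply: eq_bigr => j _; rewrite mxE mulrCA.
Qed.

(** The polarization identity with the nonnegative term [|A - B|^2 / 2]
    dropped. *)
Lemma inner_polarization A B :
  2^-1 * (inner A A - inner B B) <= inner A A - inner B A.
Proof.
rewrite /inner -!sumrB mulr_sumr; apply: ler_sum => i _.
rewrite -!sumrB mulr_sumr; apply: ler_sum => j _.
have := sqr_ge0 (A i j - B i j); nra.
Qed.

(** Entrywise [|x y| <= x^2 + y^2]: a crude Cauchy-Schwarz inequality, enough
    to dominate the cross terms by integrable functions. *)
Lemma normr_inner_le A B : `|inner A B| <= inner A A + inner B B.
Proof.
rewrite /inner -big_split /=; apply: (le_trans (ler_norm_sum _ _ _)).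
apply: ler_sum => i _; rewrite -big_split /=.
apply: (le_trans (ler_norm_sum _ _ _)); apply: ler_sum => j _.
have := sqr_ge0 (A i j - B i j); have := sqr_ge0 (A i j + B i j).
by rewrite ler_norml => ? ?; apply/andP; split; nra.
Qed.

End inner_product.

Section integrability.
Context {R : realType} {d : nat} {Omega : set 'rV[R]_d}.
Hypothesis mOmega : measurable Omega.

Lemma intbleD {g h : 'rV[R]_d -> R} :
  intble Omega g -> intble Omega h -> intble Omega (g \+ h).
Proof. by move=> ig ih; have := integrableD mOmega ig ih. Qed.

Lemma intbleB {g h : 'rV[R]_d -> R} :
  intble Omega g -> intble Omega h -> intble Omega (g \- h).
Proof. by move=> ig ih; have := integrableB mOmega ig ih. Qed.

Lemma intbleZ c {g : 'rV[R]_d -> R} :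
  intble Omega g -> intble Omega (fun x => c * g x).
Proof. by move=> ig; have := integrableZl mOmega c ig. Qed.

Lemma intble_inner {m n} {A B : 'rV[R]_d -> 'M[R]_(m, n)} :
  square_integrable Omega A -> square_integrable Omega B ->
  intble Omega (fun x => inner (A x) (B x)).
Proof.
move=> [mA iA] [mB iB].
have iAB : (lebesgue_rV d).-integrable Omega _ := intbleD iA iB.
rewrite /intble; apply: (le_integrable mOmega _ _ iAB) => [|x _].
  apply/measurable_EFinP; apply: measurable_sum => i.
  by apply: measurable_sum => j; apply: measurable_funM.
rewrite !abse_EFin lee_fin [leRHS]ger0_norm ?normr_inner_le//.
by rewrite addr_ge0 ?inner_ge0.
Qed.

End integrability.

Lemma limn_einf_ge {R : realType} {u v : (\bar R)^nat} {l : \bar R} :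
  (forall n, (v n <= u n)%E) -> v x @[x --> \oo] --> l -> (l <= limn_einf u)%E.
Proof.
move=> vu vl; rewrite -(cvg_limn_einf_sup vl).1 !limn_einf_lim.
apply: lee_lim; [exact: is_cvg_einfs|exact: is_cvg_einfs|].
apply: nearW => n; apply: le_ereal_inf_tmp => _ [m /= nm <-].
by apply: le_trans (vu m); apply: ereal_inf_lbound; exists m.
Qed.

Section dissipation.
Context {R : realType} {d : nat} {Omega : set 'rV[R]_d} {nu beta k : R}
  {nuT : ('rV[R]_d -> 'rV[R]_d) -> 'rV[R]_d -> R}
  {f : 'rV[R]_d -> R -> 'rV[R]_d}
  {w : nat -> 'rV[R]_d -> 'rV[R]_d} {q : nat -> 'rV[R]_d -> R}.
Local Notation mu := (lebesgue_rV d).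
Hypotheses (mOmega : measurable Omega) (k_gt0 : 0 < k).
Hypothesis nuT_ge0 : forall v x, Omega x -> 0 <= nuT v x.
Hypothesis hreg : method1_regular Omega nu k nuT f w q.

Let X n x := a_ nu nuT w n x *: w n.+1 x.
Let Y n x := a_prev nu nuT w n x *: w n x.

(** The weight carries the index [n-1], not [n], so that the tested backscatter
    term is bounded below by a multiple of the increment of this quantity over
    the same step. *)
Definition eddy_energy n := \int[mu]_(x in Omega) inner (Y n x) (Y n x).

Lemma inner_backscatter n x :
  inner (backscatter nu beta k nuT w n x) (w n.+1 x) =
  beta ^+ 2 / k * (inner (X n x) (X n x) - inner (Y n x) (X n x)).
Proof.
rewrite -innerBl /backscatter -/(X n x) -/(Y n x) {3}/X innerZr !innerZl.
by ring.
Qed.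

(** The polarization inequality integrated over [Omega], with the nonnegative
    eddy dissipation discarded. *)
Lemma MD_ge n :
  beta ^+ 2 / k * 2^-1 * (eddy_energy n.+1 - eddy_energy n) <=
  MD Omega nu beta k nuT w n.
Proof.
have hX : square_integrable Omega (X n) := a_velocity_L2 hreg n.
have hY : square_integrable Omega (Y n) := a_prev_velocity_L2 hreg n.
have iXX := intble_inner mOmega hX hX.
have iYY := intble_inner mOmega hY hY.
have iYX := intble_inner mOmega hY hX.
(* [Y n.+1] is [X n] by definition of the shifted weight, so that
   [eddy_energy n.+1] is the integral of [inner (X n x) (X n x)]. *)
rewrite -RintegralB// -RintegralZl//; last exact: (intbleB mOmega).
apply: le_Rintegral => //.
- by apply: (intbleZ mOmega); exact: (intbleB mOmega).
- rewrite (_ : _ \o _ = EFin \o ((fun x => beta ^+ 2 / k *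
      (inner (X n x) (X n x) - inner (Y n x) (X n x))) \+
      (fun x => nuT (w n) x * inner (vgrad (w n.+1) x) (vgrad (w n.+1) x)))).
    apply: (intbleD mOmega); last exact: (eddy_dissipation_intble hreg).
    by apply: (intbleZ mOmega); exact: (intbleB mOmega).
  by apply/funext => x /=; rewrite inner_backscatter.
- move=> x Ox; rewrite inner_backscatter -[leLHS]addr0 lerD//.
    rewrite -mulrA ler_wpM2l ?inner_polarization//.
    by rewrite divr_ge0 ?sqr_ge0 ?ltW.
  by rewrite mulr_ge0 ?inner_ge0 ?nuT_ge0.
Qed.

(** Telescoping leaves [eddy_energy N - eddy_energy 0], whose first term is
    nonnegative; the bound is therefore uniform in [N]. *)
Lemma sum_MD_ge N :
  - (beta ^+ 2 / 2 * eddy_energy 0) <=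
  k * \sum_(0 <= n < N) MD Omega nu beta k nuT w n.
Proof.
have c_ge0 : 0 <= beta ^+ 2 / 2 by rewrite divr_ge0 ?sqr_ge0.
apply: (@le_trans _ _ (beta ^+ 2 / 2 * (eddy_energy N - eddy_energy 0))).
  rewrite mulrBr lerDr mulr_ge0// /eddy_energy.
  by apply: Rintegral_ge0 => x _; exact: inner_ge0.
rewrite -telescope_sumr// !mulr_sumr; apply: ler_sum => n _.
have -> : beta ^+ 2 / 2 = k * (beta ^+ 2 / k * 2^-1) by field; rewrite gt_eqF.
by rewrite -mulrA ler_wpM2l ?MD_ge ?ltW.
Qed.

End dissipation.

Lemma cvg_invr_time {R : realType} {k : R} :
  0 < k -> (time k n)^-1 @[n --> \oo] --> 0.
Proof.
move=> k_gt0.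
have -> : (fun n => (time k n)^-1) = (fun n => n%:R^-1 * k^-1).
  by apply/funext => n; rewrite invfM.
rewrite -[0](mul0r k^-1); apply: cvgMr_tmp.
have n_gt0 : \forall n \near \oo, 0 < n%:R :> R.
  by exists 1%N => // n /=; rewrite ltr0n.
exact: (gtr0_cvgV0 n_gt0).2 cvgr_idn.
Qed.

Theorem proposition4p3 (R : realType) (d : nat) (Omega : set 'rV[R]_d)
    (nu beta k : R)
    (nuT : ('rV[R]_d -> 'rV[R]_d) -> 'rV[R]_d -> R)
    (f : 'rV[R]_d -> R -> 'rV[R]_d)
    (w : nat -> 'rV[R]_d -> 'rV[R]_d) (q : nat -> 'rV[R]_d -> R)
    (hd : d = 2%N \/ d = 3%N)
    (Omega_open : open Omega) (Omega_connected : connected Omega)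
    (Omega_nonempty : Omega !=set0) (Omega_bounded : bounded_set Omega)
    (nu_gt0 : 0 < nu) (beta_gt0 : 0 < beta) (k_gt0 : 0 < k)
    (nuT_ge0 : forall v x, Omega x -> 0 <= nuT v x)
    (hsol : method1_solution Omega nu beta k nuT f w q)
    (hreg : method1_regular Omega nu k nuT f w q)
    (f_bounded : (ereal_sup [set L2norm Omega (fun x => f x (time k n))
                            | n in [set n : nat | (0 < n)%N]] < +oo)%E) :
  (0 <= limn_einf (fun N : nat =>
     ((time k N)^-1 *
      (k * \sum_(0 <= n < N.+1) MD Omega nu beta k nuT w n))%:E))%E.
Proof.
have mOmega : measurable Omega := open_rV_measurable Omega_open.
set c := - (beta ^+ 2 / 2 * eddy_energy (Omega := Omega) (nu := nu)
  (nuT := nuT) (w := w) 0).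
apply: (@limn_einf_ge _ _ (fun N => ((time k N)^-1 * c)%:E)) => [N|].
  (* The comparison also holds at [N = 0], where [(time k 0)^-1] is [0]. *)
  rewrite lee_fin ler_wpM2l//; first by rewrite invr_ge0 mulr_ge0 ?ler0n ?ltW.
  exact: sum_MD_ge mOmega k_gt0 nuT_ge0 hreg N.+1.
apply: cvg_EFin; first by apply: nearW.
by rewrite -[0](mul0r c); apply: cvgMr_tmp; exact: cvg_invr_time.
Qed.
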